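(* Let $f:\mathbb{R}^d\to\mathbb{R}$ be an $L$-recursively Lipschitz function represented by a linear arithmetic circuit $\mathcal{C}$ of size $s(\mathcal{C})$. For every $N\in\mathbb{R}$, one can construct a function $g:\mathbb{R}^d\to\mathbb{R}$ such that: 1. $|f(\mathbf{x})-g(\mathbf{x})|\le 2^{-N}$ for all $\mathbf{x}\in\mathbb{R}^d$; 2. $g$ is $L$-Lipschitz; 3. $g$ is $2^{3s(\mathcal{C})+N}$-smooth.
   Context: Lipschitz and smooth are with respect to the Euclidean norm; a function is $S$-smooth if it is differentiable with $\|\nabla g(\mathbf{x})-\nabla g(\mathbf{y})\|\le S\|\mathbf{x}-\mathbf{y}\|$ for all $\mathbf{x},\mathbf{y}$. A linear arithmetic circuit $\mathcal{C}$ is a directed acyclic graph whose nodes are input nodes, gate nodes, and output nodes. Each gate node is one of $+$, $\max$, $\times\zeta$, $\mathrm{const}(c)$, where $\mathrm{const}(c)$ is the constant $c\in[-1,1]$ and $\times\zeta$ is multiplication by a constant $\zeta\in[-1,1]$. Moreover: (1) there can be more than one input node, each with 0 incoming edges and any number of outgoing edges; (2) gates $+$ and $\max$ have two incoming edges and any number of outgoing edges; (3) a gate $\mathrm{const}(c)$ has 0 incoming edges and any number of outgoing edges; (4) a gate $\times\zeta$ has 1 incoming edge and any number of outgoing edges; (5) there is exactly one output node, with 1 incoming edge and 0 outgoing edges. The size $s(\mathcal{C})$ is the number of nodes of $\mathcal{C}$. The circuit represents $f:\mathbb{R}^d\to\mathbb{R}$ in the natural way: the input nodes carry the variables $x_1,\dots,x_d$,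 each gate applies its operation to the values on its incoming edges, and the value at the output node is $f(\mathbf{x})$. $L$-recursively Lipschitz: let $v_1,\dots,v_n$ be the nodes of $\mathcal{C}$ and let $f_i$ be the function of $\mathbf{x}$ computed at node $v_i$ (i.e. the function computed if $v_i$ were the output). The function $f$ (with circuit $\mathcal{C}$) is called $L$-recursively Lipschitz if the Lipschitz constants $L_i$ of the functions $f_i$ are given recursively by: if $v_i$ is a $+$ gate with $f_i=f_j+f_k$, then $L_i=L_j+L_k$; if $v_i$ is a $\max$ gate with $f_i=\max\{f_j,f_k\}$, then $L_i=\max\{L_j,L_k\}$; if $v_i$ is a $\mathrm{const}(c)$ gate, then $L_i=0$; if $v_i$ is a $\times\zeta$ gate with $f_i=\zeta\cdot f_j$, then $L_i=|\zeta|\cdot L_j$; if $v_i$ is an input node, then $L_i=1$; and the Lipschitz constant $L$ of $f$ itself, which is the evaluation of the last (output) node, is the one given by this recursion (the output node has the same function and constant as its predecessor). *)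

(* Defs.v *)
From HB Require Import structures.
From mathcomp Require Import all_boot all_order all_algebra.
From mathcomp Require Import all_classical all_reals all_analysis.

Set Implicit Arguments.
Unset Strict Implicit.
Unset Printing Implicit Defensive.

Import Order.TTheory GRing.Theory Num.Theory.
Import numFieldNormedType.Exports.

Local Open Scope ring_scope.

(* The kind of a node together with the sources of its incoming edges. The two
   sources of a [+] or [max] gate may coincide (parallel edges, as in x + x). *)
Inductive gate (R : realType) (d : nat) (V : Type) : Type :=
| Input of 'I_d
| Add of V & V
| Max of V & V
| Scale of R & V
| Const of R
| Output of V.

Arguments Input {R d V} _.
Arguments Add {R d V} _ _.
Arguments Max {R d V} _ _.
Arguments Scale {R d V} _ _.
Arguments Const {R d V} _.
Arguments Output {R d V} _.

Definition sources (R : realType) (d : nat) (V : Type) (g : gate R d V) : seq V :=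
  match g with
  | Input _ | Const _ => [::]
  | Add u v | Max u v => [:: u; v]
  | Scale _ u | Output u => [:: u]
  end.

Definition edge (R : realType) (d : nat) (V : finType) (gt : V -> gate R d V) :
    rel V :=
  fun u v => u \in sources (gt v).

Definition is_output (R : realType) (d : nat) (V : Type) (g : gate R d V) : bool :=
  if g is Output _ then true else false.

Definition bounded_constant (R : realType) (d : nat) (V : Type)
    (g : gate R d V) : Prop :=
  match g with
  | Scale c _ | Const c => c \in `[-1, 1]
  | _ => True
  end.

Record linear_circuit (R : realType) (d : nat) := LinearCircuit {
  node : finType;
  node_gate : node -> gate R d node;
  output : node;
  circuit_acyclic : forall u v,
    edge node_gate u v -> ~~ connect (edge node_gate) v u;
  circuit_bounded : forall v, bounded_constant (node_gate v);
  circuit_inputs : forall i : 'I_d, exists! v, node_gate v = Input i;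
  circuit_output : forall v, is_output (node_gate v) = (v == output);
  circuit_output_sink : forall v, ~~ edge node_gate output v
}.

Definition circuit_size (R : realType) (d : nat) (C : linear_circuit R d) : nat :=
  #|node C|.

(* [F v] is the function computed at [v]: since the circuit is acyclic, these
   equations have exactly one solution. *)
Definition computed_functions (R : realType) (d : nat) (C : linear_circuit R d)
    (F : node C -> 'rV[R]_d -> R) : Prop :=
  forall v x, F v x =
    match node_gate v with
    | Input i => x 0 i
    | Add u w => F u x + F w x
    | Max u w => Num.max (F u x) (F w x)
    | Scale c u => c * F u x
    | Const c => c
    | Output u => F u x
    end.

Definition recursive_constants (R : realType) (d : nat) (C : linear_circuit R d)
    (K : node C -> R) : Prop :=
  forall v, K v =
    match node_gate v with
    | Input _ => 1
    | Add u w => K u + K w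
    | Max u w => Num.max (K u) (K w)
    | Scale c u => `|c| * K u
    | Const _ => 0
    | Output u => K u
    end.

(* The library norm on ['rV[R]_d] is the sup norm. *)
Definition enorm (R : realType) (d : nat) (x : 'rV[R]_d) : R :=
  Num.sqrt (\sum_(i < d) x 0 i ^+ 2).

Definition elipschitz (R : realType) (d : nat) (L : R) (g : 'rV[R]_d -> R) : Prop :=
  forall x y, `|g x - g y| <= L * enorm (x - y).

Definition gradient (R : realType) (d : nat) (g : 'rV[R]_d -> R) (x : 'rV[R]_d) :
    'rV[R]_d :=
  \row_(i < d) 'D_(delta_mx 0 i) g x.

Definition esmooth (R : realType) (d : nat) (S : R) (g : 'rV[R]_d -> R) : Prop :=
  (forall x, differentiable g x) /\
  (forall x y, enorm (gradient g x - gradient g y) <= S * enorm (x - y)).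

(* [f] is represented by [C] and is [L]-recursively Lipschitz with respect to
   [C]. The constants are those of the recursion, not the least possible ones. *)
Definition recursively_lipschitz (R : realType) (d : nat) (C : linear_circuit R d)
    (f : 'rV[R]_d -> R) (L : R) : Prop :=
  exists (F : node C -> 'rV[R]_d -> R) (K : node C -> R),
    [/\ computed_functions F, recursive_constants K,
        forall v, elipschitz (K v) (F v),
        f = F (output C) & L = K (output C)].

(* Main.v *)
(* Replace each max(a, b) in the circuit by (a + b + sqrt((a - b)^2 + e^2)) / 2.
   This function is nonexpansive for the sup norm and its gradient is a convex
   combination of the gradients of a and b, so the constants of the recursion
   survive; it is within e of max(a, b), and its weights are (1/e)-Lipschitz in
   a - b. By induction on the depth n of a node (its number of proper ancestors),
   the error is at most 2^n e, the gradient is at most 2^n, and the smoothness is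
   at most 2 * 4^n / e. With e = 2^(-N-n) at the output node, the smoothness is at
   most 2^(3n+1+N), and n is less than the size of the circuit. *)
Require Import Defs.
From mathcomp Require Import all_boot all_order all_algebra.
From mathcomp Require Import all_classical all_reals all_analysis.
From mathcomp Require Import ring lra zify.

Set Implicit Arguments.
Unset Strict Implicit.
Unset Printing Implicit Defensive.

Import Order.TTheory GRing.Theory Num.Theory.
Import numFieldNormedType.Exports.

Local Open Scope ring_scope.

(** * The Euclidean norm *)

Lemma enorm_ge0 (R : realType) (d : nat) (x : 'rV[R]_d) : 0 <= enorm x.
Proof. exact: sqrtr_ge0. Qed.

Lemma sqr_enorm (R : realType) (d : nat) (x : 'rV[R]_d) :
  enorm x ^+ 2 = \sum_(i < d) x 0 i ^+ 2.
Proof. by rewrite sqr_sqrtr// sumr_ge0// => i _; rewrite sqr_ge0. Qed.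

Lemma enorm0 (R : realType) (d : nat) : enorm (0 : 'rV[R]_d) = 0.
Proof.
by rewrite /enorm big1 ?sqrtr0// => i _; rewrite mxE expr0n.
Qed.

Lemma enorm_delta (R : realType) (d : nat) (i : 'I_d) :
  enorm (delta_mx 0 i : 'rV[R]_d) = 1.
Proof.
rewrite /enorm (bigD1 i)//= big1 ?addr0 => [|j /negPf ji].
  by rewrite mxE !eqxx expr1n sqrtr1.
by rewrite mxE ji andbF expr0n.
Qed.

Lemma enormZ (R : realType) (d : nat) (c : R) (x : 'rV[R]_d) :
  enorm (c *: x) = `|c| * enorm x.
Proof.
rewrite /enorm -sqrtr_sqr -sqrtrM ?sqr_ge0// mulr_sumr.
by congr Num.sqrt; apply: eq_bigr => i _; rewrite mxE exprMn.
Qed.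

Lemma enorm_eq0 (R : realType) (d : nat) (x : 'rV[R]_d) : enorm x = 0 -> x = 0.
Proof.
move=> x0; have /eqP := sqr_enorm x; rewrite x0 expr0n/= eq_sym.
rewrite psumr_eq0 => [/allP s0|i _]; last exact: sqr_ge0.
apply/rowP => i; rewrite mxE; apply/eqP.
by rewrite -sqrf_eq0; apply: s0; rewrite mem_index_enum.
Qed.

Lemma coord_le_enorm (R : realType) (d : nat) (x : 'rV[R]_d) (i : 'I_d) :
  `|x 0 i| <= enorm x.
Proof.
rewrite -sqrtr_sqr ler_sqrt; last by apply: sumr_ge0 => j _; exact: sqr_ge0.
by rewrite (bigD1 i)//= lerDl sumr_ge0// => j _; exact: sqr_ge0.
Qed.

(** Sum [(|y| x_i - |x| y_i)^2 >= 0] over the coordinates and divide by [2 |x| |y|]; a vanishing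
    norm is treated apart because of the division. *)
Lemma cauchy_schwarz_row (R : realType) (d : nat) (x y : 'rV[R]_d) :
  \sum_(i < d) x 0 i * y 0 i <= enorm x * enorm y.
Proof.
have [x0|nx0] := eqVneq (enorm x) 0.
  by rewrite x0 mul0r big1// => i _; rewrite (enorm_eq0 x0) mxE mul0r.
have [y0|ny0] := eqVneq (enorm y) 0.
  by rewrite y0 mulr0 big1// => i _; rewrite (enorm_eq0 y0) mxE mulr0.
have p0 : 0 < enorm x * enorm y.
  by rewrite mulr_gt0// lt_def ?nx0 ?ny0 enorm_ge0.
have p20 : 0 < 2 * (enorm x * enorm y) by rewrite mulr_gt0.
rewrite -(ler_pM2l p20) mulr_sumr.
apply: (@le_trans _ _ (\sum_(i < d) (enorm y ^+ 2 * x 0 i ^+ 2 +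
    enorm x ^+ 2 * y 0 i ^+ 2))).
  apply: ler_sum => i _.
  by have := sqr_ge0 (enorm y * x 0 i - enorm x * y 0 i); nra.
by rewrite big_split/= -!mulr_sumr -!sqr_enorm; lra.
Qed.

Lemma enormD (R : realType) (d : nat) (x y : 'rV[R]_d) :
  enorm (x + y) <= enorm x + enorm y.
Proof.
rewrite -(ler_pXn2r (ltn0Sn 1)) ?nnegrE ?addr_ge0 ?enorm_ge0//.
rewrite sqrrD !sqr_enorm (eq_bigr (fun i => x 0 i ^+ 2 + 2 * (x 0 i * y 0 i) +
  y 0 i ^+ 2)) => [|i _]; last by rewrite mxE; ring.
rewrite !big_split/= -mulr_sumr lerD2r lerD2l -(mulr_natl (_ * _)).
by rewrite ler_pM2l// cauchy_schwarz_row.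
Qed.

(** * The hyperbola as a smooth absolute value, and the smoothed maximum *)

Definition hyperbola (R : realType) (e t : R) : R := Num.sqrt (t ^+ 2 + e ^+ 2).

Definition hyperbola_slope (R : realType) (e t : R) : R := t / hyperbola e t.

(** This is the identity [max(a, b) = (a + b + |a - b|) / 2] with the absolute value replaced by
    [hyperbola e]. *)
Definition smooth_max (R : realType) (e a b : R) : R :=
  2^-1 * (a + b + hyperbola e (a - b)).

Lemma sqr_hyperbola (R : realType) (e t : R) :
  hyperbola e t ^+ 2 = t ^+ 2 + e ^+ 2.
Proof. by rewrite sqr_sqrtr// addr_ge0// sqr_ge0. Qed.

Lemma hyperbola_ge (R : realType) (e t : R) : e <= hyperbola e t.
Proof.
apply: le_trans (ler_norm _) _; rewrite -sqrtr_sqr ler_sqrt ?lerDr ?sqr_ge0//.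
by rewrite addr_ge0// sqr_ge0.
Qed.

Lemma hyperbola_ge_norm (R : realType) (e t : R) : `|t| <= hyperbola e t.
Proof.
by rewrite -sqrtr_sqr ler_sqrt ?lerDl ?sqr_ge0// addr_ge0// sqr_ge0.
Qed.

Lemma hyperbola_le (R : realType) (e t : R) : 0 < e ->
  hyperbola e t <= `|t| + e.
Proof.
move=> e0.
rewrite -(ler_pXn2r (ltn0Sn 1)) ?nnegrE ?addr_ge0 ?sqrtr_ge0 ?(ltW e0)//.
rewrite sqr_hyperbola -(real_normK (num_real t)).
by have := normr_ge0 t; nra.
Qed.

(** The difference of the squares is [(s - t)(s + t)], and [|s + t|] is at most the sum of the two
    values of the hyperbola, which can be cancelled. *)
Lemma hyperbola_lipschitz (R : realType) (e s t : R) : 0 < e ->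
  `|hyperbola e s - hyperbola e t| <= `|s - t|.
Proof.
move=> e0.
have hs := hyperbola_ge e s; have ht := hyperbola_ge e t.
have p0 : 0 < hyperbola e s + hyperbola e t by lra.
rewrite -(ler_pM2r p0) -[X in `|_| * X]gtr0_norm// -normrM -subr_sqr.
rewrite !sqr_hyperbola (_ : _ - _ = (s - t) * (s + t)); last by ring.
rewrite normrM ler_wpM2l//.
by rewrite (le_trans (ler_normD _ _))// lerD// hyperbola_ge_norm.
Qed.

Lemma hyperbola_slope_norm (R : realType) (e t : R) : 0 < e ->
  `|hyperbola_slope e t| <= 1.
Proof.
move=> e0.
have h0 : 0 < hyperbola e t by rewrite (lt_le_trans e0)// hyperbola_ge.
by rewrite normf_div (gtr0_norm h0) ler_pdivrMr// mul1r hyperbola_ge_norm.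
Qed.

(** Since the weights in the gradient of [smooth_max] are [(1 + slope) / 2] and [(1 - slope) / 2],
    the constant [2 / e] here makes them (1/e)-Lipschitz. *)
Lemma hyperbola_slope_lipschitz (R : realType) (e s t : R) : 0 < e ->
  `|hyperbola_slope e s - hyperbola_slope e t| <= 2 / e * `|s - t|.
Proof.
move=> e0.
have hs : 0 < hyperbola e s by rewrite (lt_le_trans e0)// hyperbola_ge.
have ht : 0 < hyperbola e t by rewrite (lt_le_trans e0)// hyperbola_ge.
(* Each of the two terms in the bracket is at most [|s - t|], and the factor in front is at most
   [1 / e]. *)
have -> : hyperbola_slope e s - hyperbola_slope e t =
    (hyperbola e t)^-1 *
    ((s - t) + hyperbola_slope e s * (hyperbola e t - hyperbola e s)).
  by rewrite /hyperbola_slope; field; rewrite !gt_eqF.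
have hV : (hyperbola e t)^-1 <= e^-1 by rewrite lef_pV2 ?posrE ?hyperbola_ge.
rewrite normrM gtr0_norm ?invr_gt0// (mulrC 2) -[leRHS]mulrA.
apply: ler_pM => //; first by rewrite invr_ge0 ltW.
rewrite (le_trans (ler_normD _ _))// mulr_natl mulr2n lerD2l normrM.
rewrite -[leRHS]mul1r ler_pM// ?hyperbola_slope_norm//.
by rewrite (distrC s) hyperbola_lipschitz.
Qed.

Lemma is_derive_hyperbola (R : realType) (e t : R) : 0 < e ->
  is_derive t 1 (hyperbola e) (hyperbola_slope e t).
Proof.
move=> e0.
have h0 : 0 < t ^+ 2 + e ^+ 2 by rewrite ltr_wpDl ?sqr_ge0 ?exprn_gt0.
have ds := is_derive1_sqrt h0.
have di : is_derive t 1 (fun u : R => u ^+ 2 + e ^+ 2) (2 * t).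
  apply: is_derive_eq.
  by rewrite /GRing.scale/=; ring.
have := @is_derive1_comp R Num.sqrt (fun u : R => u ^+ 2 + e ^+ 2) _ _ _ ds di.
rewrite /hyperbola_slope /hyperbola.
move=> /is_derive_eq; apply.
rewrite /GRing.scale/=.
have s0 : 0 < Num.sqrt (t ^+ 2 + e ^+ 2) by rewrite sqrtr_gt0.
by field; rewrite gt_eqF.
Qed.

(** With [p = a - a'] and [q = b - b'], the hyperbola term changes by at most [|p - q|], so the
    total change lies between [(p + q - |p - q|) / 2 = min(p, q)] and
    [(p + q + |p - q|) / 2 = max(p, q)]. *)
Lemma smooth_max_lipschitz (R : realType) (e a b a' b' : R) : 0 < e ->
  `|smooth_max e a b - smooth_max e a' b'| <= Num.max `|a - a'| `|b - b'|.
Proof.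
move=> e0; have := hyperbola_lipschitz (a - b) (a' - b') e0.
rewrite /smooth_max ler_norml => /andP[]; move: (hyperbola _ _) (hyperbola _ _).
move=> h h' lo up.
have := ler_norm (a - a'); have := ler_norm (b - b').
have := ler_norm (- (a - a')); have := ler_norm (- (b - b')); rewrite !normrN.
rewrite le_max; case: (lerP `|a - a'| `|b - b'|) => ab ? ? ? ?.
  by apply/orP; right; rewrite ler_norml;
    case: (ler0P (a - b - (a' - b'))) lo up => ? ? ?; apply/andP; split; lra.
by apply/orP; left; rewrite ler_norml;
  case: (ler0P (a - b - (a' - b'))) lo up => ? ? ?; apply/andP; split; lra.
Qed.

(** The error is half the gap between the hyperbola and the absolute value, a gap that lies between
    0 and [e]. *)
Lemma smooth_max_error (R : realType) (e a b : R) : 0 < e ->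
  `|Num.max a b - smooth_max e a b| <= e.
Proof.
move=> e0; have := hyperbola_le (a - b) e0; have := hyperbola_ge_norm e (a - b).
rewrite /smooth_max (ler_norml _ e); move: (hyperbola _ _) => h.
by case: (lerP a b) => ab; case: (ler0P (a - b)) => ? ? ?; apply/andP; split; lra.
Qed.

(** * Gradients, up to that of the smoothed maximum *)

Lemma gradient_coord (R : realType) (d : nat) (i : 'I_d) (x : 'rV[R]_d) :
  gradient (fun y : 'rV[R]_d => y 0 i) x = delta_mx 0 i.
Proof.
apply/rowP => j; rewrite mxE.
have did : derivable (@id 'rV[R]_d) x (delta_mx 0 j) by exact: derivable_id.
have /matrixP/(_ 0 i) := derive_mx did.
rewrite derive_id !mxE => <-.
by rewrite eq_sym.
Qed.

Lemma gradient_cst (R : realType) (d : nat) (c : R) (x : 'rV[R]_d) :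
  gradient (fun=> c) x = 0.
Proof. by apply/rowP => j; rewrite !mxE derive_cst. Qed.

Lemma gradientD (R : realType) (d : nat) (f g : 'rV[R]_d -> R) (x : 'rV[R]_d) :
  differentiable f x -> differentiable g x ->
  gradient (f + g) x = gradient f x + gradient g x.
Proof.
move=> df dg; apply/rowP => j; rewrite !mxE.
by rewrite deriveD//; exact: diff_derivable.
Qed.

Lemma gradientZ (R : realType) (d : nat) (c : R) (f : 'rV[R]_d -> R)
    (x : 'rV[R]_d) :
  differentiable f x -> gradient (c \*: f) x = c *: gradient f x.
Proof.
move=> df; apply/rowP => j; rewrite !mxE.
by rewrite deriveZ//; exact: diff_derivable.
Qed.

Lemma gradientB (R : realType) (d : nat) (f g : 'rV[R]_d -> R) (x : 'rV[R]_d) :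
  differentiable f x -> differentiable g x ->
  gradient (f - g) x = gradient f x - gradient g x.
Proof.
move=> df dg; apply/rowP => j; rewrite !mxE.
by rewrite deriveB//; exact: diff_derivable.
Qed.

Lemma gradient_comp (R : realType) (d : nat) (h : R -> R) (dh : R)
    (f : 'rV[R]_d -> R) (x : 'rV[R]_d) :
  differentiable f x -> is_derive (f x) 1 h dh ->
  gradient (h \o f) x = dh *: gradient f x.
Proof.
move=> df [hd hE].
have dh' : differentiable h (f x) by exact/derivable1_diffP.
apply/rowP => j; rewrite !mxE !deriveE//; last exact: differentiable_comp.
by rewrite diff_comp//= diff1E// derive1E hE /GRing.scale/= mulrC.
Qed.

(** Casts the pointwise formula into sums, multiples and compositions of functions, the form to
    which the differentiation rules apply. *)
Lemma smooth_maxE (R : realType) (d : nat) (e : R) (f g : 'rV[R]_d -> R) :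
  (fun x => smooth_max e (f x) (g x)) =
  2^-1 \*: (f + g + (hyperbola e \o (f - g))).
Proof. by []. Qed.

Lemma differentiable_smooth_max (R : realType) (d : nat) (e : R)
    (f g : 'rV[R]_d -> R) (x : 'rV[R]_d) : 0 < e ->
  differentiable f x -> differentiable g x ->
  differentiable (fun x => smooth_max e (f x) (g x)) x.
Proof.
move=> e0 df dg; rewrite smooth_maxE.
apply: differentiableZ; apply: differentiableD; first exact: differentiableD.
apply: differentiable_comp; first exact: differentiableB.
by apply/derivable1_diffP; have [] := is_derive_hyperbola (f x - g x) e0.
Qed.

Lemma gradient_smooth_max (R : realType) (d : nat) (e : R)
    (f g : 'rV[R]_d -> R) (x : 'rV[R]_d) : 0 < e ->
  differentiable f x -> differentiable g x ->
  gradient (fun x => smooth_max e (f x) (g x)) x =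
  ((1 + hyperbola_slope e (f x - g x)) / 2) *: gradient f x +
  ((1 - hyperbola_slope e (f x - g x)) / 2) *: gradient g x.
Proof.
move=> e0 df dg; have dB : differentiable (f - g) x by exact: differentiableB.
have dH := is_derive_hyperbola ((f - g) x) e0.
have dC : differentiable (hyperbola e \o (f - g)) x.
  apply: differentiable_comp => //.
  by apply/derivable1_diffP; case: dH.
have dD : differentiable (f + g) x by exact: differentiableD.
rewrite smooth_maxE gradientZ; last exact: differentiableD.
rewrite !gradientD// (gradient_comp dB dH) gradientB//.
by apply/rowP => j; rewrite !mxE; field.
Qed.

(** The two weights are nonnegative and sum to 1. This serves both for the gradient of a smoothed
    maximum and for the increment of that gradient. *)
Lemma enorm_convex (R : realType) (d : nat) (s : R) (x y : 'rV[R]_d) (K : R) :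
  `|s| <= 1 -> enorm x <= K -> enorm y <= K ->
  enorm (((1 + s) / 2) *: x + ((1 - s) / 2) *: y) <= K.
Proof.
rewrite ler_norml => /andP[s1 s2] xK yK; apply: le_trans (enormD _ _) _.
rewrite !enormZ !ger0_norm; [|lra|lra].
by have := enorm_ge0 x; have := enorm_ge0 y; nra.
Qed.

(** * Approximation carried through each kind of gate *)

(* [e] is the parameter of [smooth_max], [n] a bound on the depth of the node. The
   [- 1] absorbs the error [e] added by a [max]; the [4] absorbs the
   [2 * 4 ^+ n * (2 / e)] that a [max] adds to the smoothness. *)
Definition smooth_approx (R : realType) (d : nat) (e : R) (n : nat) (K : R)
    (f g : 'rV[R]_d -> R) : Prop :=
  [/\ forall x, `|f x - g x| <= (2 ^+ n - 1) * e,
      elipschitz K g,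
      forall x, enorm (gradient g x) <= K,
      K <= 2 ^+ n &
      esmooth (4 ^+ n * (2 / e)) g].

Lemma smoothness_ge0 (R : realType) (e : R) (n : nat) :
  0 < e -> 0 <= 4 ^+ n * (2 / e).
Proof. by move=> e0; rewrite mulr_ge0 ?exprn_ge0 ?divr_ge0 ?(ltW e0). Qed.

(** All bounds grow with the index, so the two sources of a gate can be brought to a common one. *)
Lemma smooth_approx_widen (R : realType) (d : nat)
    (e : R) (m n : nat) (K : R) (f g : 'rV[R]_d -> R) :
  0 < e ->
  (m <= n)%N -> smooth_approx e m K f g -> smooth_approx e n K f g.
Proof.
move=> e0 mn [err lip grd Kn [dg smo]]; have two : 2 ^+ m <= 2 ^+ n :> R.
  by rewrite ler_eXn2l// ltr1n.
split=> //.
  by move=> x; rewrite (le_trans (err x))// ler_wpM2r ?(ltW e0)// lerB.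
  exact: le_trans two.
split=> // x y; rewrite (le_trans (smo x y))// ler_wpM2r ?enorm_ge0//.
by rewrite ler_wpM2r ?divr_ge0 ?(ltW e0)// ler_eXn2l// ltr1n.
Qed.

Lemma smooth_approx_input (R : realType) (d : nat)
    (e : R) (n : nat) (i : 'I_d) :
  0 < e ->
  smooth_approx e n 1 (fun x : 'rV[R]_d => x 0 i) (fun x => x 0 i).
Proof.
move=> e0.
have two : 1 <= 2 ^+ n :> R by rewrite exprn_ege1// ler1n.
split=> //.
- by move=> x; rewrite subrr normr0 mulr_ge0 ?(ltW e0)// subr_ge0.
- move=> x y; rewrite mul1r; apply: le_trans (coord_le_enorm _ i).
  by rewrite !mxE.
- by move=> x; rewrite gradient_coord enorm_delta.
- split=> [x|x y]; first exact: differentiable_coord.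
  by rewrite !gradient_coord subrr enorm0 mulr_ge0 ?enorm_ge0 ?smoothness_ge0.
Qed.

Lemma smooth_approx_cst (R : realType) (d : nat)
    (e : R) (n : nat) (c : R) :
  0 < e ->
  smooth_approx e n 0 (fun _ : 'rV[R]_d => c) (fun=> c).
Proof.
move=> e0.
have two : 1 <= 2 ^+ n :> R by rewrite exprn_ege1// ler1n.
split=> //.
- by move=> x; rewrite subrr normr0 mulr_ge0 ?(ltW e0)// subr_ge0.
- by move=> x y; rewrite subrr normr0 mul0r.
- by move=> x; rewrite gradient_cst enorm0.
- split=> [x|x y]; first exact: differentiable_cst.
  by rewrite !gradient_cst subrr enorm0 mulr_ge0 ?enorm_ge0 ?smoothness_ge0.
Qed.

Lemma smooth_approxZ (R : realType) (d : nat)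
    (e : R) (n : nat) (c K : R) (f g : 'rV[R]_d -> R) :
  0 < e ->
  `|c| <= 1 -> smooth_approx e n K f g ->
  smooth_approx e n (`|c| * K) (fun x => c * f x) (fun x => c * g x).
Proof.
move=> e0 c1 [err lip grd Kn [dg smo]]; split.
- move=> x; rewrite -mulrBr normrM (le_trans _ (err x))//.
  by rewrite ler_piMl.
- by move=> x y; rewrite -mulrBr normrM -mulrA ler_wpM2l.
- by move=> x; rewrite gradientZ// enormZ ler_wpM2l.
- have [K0|K0] := leP 0 K; first by rewrite (le_trans _ Kn)// ler_piMl.
  by rewrite (@le_trans _ _ 0) ?exprn_ge0// nmulr_lle0.
- split=> [x|x y]; first exact: differentiableZ.
  rewrite !gradientZ// -scalerBr enormZ (le_trans _ (smo x y))//.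
  by rewrite ler_piMl ?enorm_ge0.
Qed.

(** Errors, gradients and smoothness at most double, and [2 * (2 ^+ n - 1) <= 2 ^+ n.+1 - 1]; the
    factor 4 allowed for the smoothness is more than enough. *)
Lemma smooth_approxD (R : realType) (d : nat)
    (e : R) (n : nat) (K1 K2 : R) (f1 f2 g1 g2 : 'rV[R]_d -> R) :
  0 < e ->
  smooth_approx e n K1 f1 g1 -> smooth_approx e n K2 f2 g2 ->
  smooth_approx e n.+1 (K1 + K2) (fun x => f1 x + f2 x) (fun x => g1 x + g2 x).
Proof.
move=> e0 [err1 lip1 grd1 Kn1 [dg1 smo1]] [err2 lip2 grd2 Kn2 [dg2 smo2]].
split.
- move=> x; rewrite opprD addrACA (le_trans (ler_normD _ _))//.
  by have := err1 x; have := err2 x; rewrite exprS; nra.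
- move=> x y; rewrite opprD addrACA (le_trans (ler_normD _ _))//.
  by rewrite mulrDl lerD.
- by move=> x; rewrite gradientD// (le_trans (enormD _ _))// lerD.
- by rewrite exprS; lra.
- split=> [x|x y]; first exact: differentiableD.
  rewrite !gradientD// opprD addrACA (le_trans (enormD _ _))//.
  have := smo1 x y; have := smo2 x y; rewrite exprS.
  by have := mulr_ge0 (smoothness_ge0 n e0) (enorm_ge0 (x - y)); lra.
Qed.

Lemma smooth_approx_max (R : realType) (d : nat)
    (e : R) (n : nat) (K1 K2 : R) (f1 f2 g1 g2 : 'rV[R]_d -> R) :
  0 < e ->
  smooth_approx e n K1 f1 g1 -> smooth_approx e n K2 f2 g2 ->
  smooth_approx e n.+1 (Num.max K1 K2) (fun x => Num.max (f1 x) (f2 x))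
    (fun x => smooth_max e (g1 x) (g2 x)).
Proof.
move=> e0 [err1 lip1 grd1 Kn1 [dg1 smo1]] [err2 lip2 grd2 Kn2 [dg2 smo2]].
have two : 1 <= 2 ^+ n :> R by rewrite exprn_ege1// ler1n.
split.
(* The exact maximum is nonexpansive, so it passes on the errors of its arguments; smoothing it adds
   [e]. *)
- move=> x; apply: (@le_trans _ _ ((2 ^+ n - 1) * e + e)); last first.
    by rewrite exprS; nra.
  rewrite -[_ - _](subrKA (Num.max (g1 x) (g2 x))).
  rewrite (le_trans (ler_normD _ _))// lerD ?smooth_max_error//.
  move: (err1 x) (err2 x); rewrite !ler_norml.
  move: (_ * e) => E /andP[? ?] /andP[? ?].
  by case: (lerP (f1 x) (f2 x)); case: (lerP (g1 x) (g2 x)) => ? ?;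
    apply/andP; split; lra.
- move=> x y; rewrite (le_trans (smooth_max_lipschitz _ _ _ _ e0))//.
  rewrite ge_max (le_trans (lip1 x y)) ?(le_trans (lip2 x y))//.
    by rewrite ler_wpM2r ?enorm_ge0// le_max lexx orbT.
  by rewrite ler_wpM2r ?enorm_ge0// le_max lexx.
- move=> x; rewrite gradient_smooth_max// enorm_convex ?hyperbola_slope_norm//.
    by rewrite le_max grd1.
  by rewrite le_max grd2 orbT.
- by rewrite exprS ge_max; apply/andP; split; lra.
split=> [x|x y]; first exact: differentiable_smooth_max.
rewrite !gradient_smooth_max//.
set s := hyperbola_slope e (g1 x - g2 x).
set t := hyperbola_slope e (g1 y - g2 y).
(* The increment is split in two: the gradients move while the weights stay those of [x], then the
   weights move while the gradients stay those of [y]. *)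
have -> : ((1 + s) / 2) *: gradient g1 x + ((1 - s) / 2) *: gradient g2 x -
    (((1 + t) / 2) *: gradient g1 y + ((1 - t) / 2) *: gradient g2 y) =
    (((1 + s) / 2) *: (gradient g1 x - gradient g1 y) +
     ((1 - s) / 2) *: (gradient g2 x - gradient g2 y)) +
    ((s - t) / 2) *: (gradient g1 y - gradient g2 y).
  by apply/rowP => j; rewrite !mxE; field.
have conv := enorm_convex (hyperbola_slope_norm (g1 x - g2 x) e0)
  (smo1 x y) (smo2 x y).
(* Here and in [gB] the constants [K1] and [K2] are replaced by their bound [2 ^+ n]. *)
have grdB : enorm (gradient g1 y - gradient g2 y) <= 2 * 2 ^+ n.
  rewrite (le_trans (enormD _ _))// -scaleN1r enormZ normrN1 mul1r.
  by have := grd1 y; have := grd2 y; lra.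
have gB : `|g1 x - g2 x - (g1 y - g2 y)| <= 2 * 2 ^+ n * enorm (x - y).
  have -> : g1 x - g2 x - (g1 y - g2 y) = (g1 x - g1 y) - (g2 x - g2 y) by ring.
  rewrite (le_trans (ler_normB _ _))//.
  by have := lip1 x y; have := lip2 x y; have := enorm_ge0 (x - y); nra.
have st : `|s - t| <= 2 / e * (2 * 2 ^+ n * enorm (x - y)).
  rewrite (le_trans (hyperbola_slope_lipschitz _ _ e0))// ler_wpM2l//.
  by rewrite divr_ge0 ?(ltW e0).
rewrite (le_trans (enormD _ _))// enormZ.
(* Of the four shares, one pays for the moving gradients; the moving weights need two of the other
   three. *)
have -> : 4 ^+ n.+1 * (2 / e) * enorm (x - y) =
    4 ^+ n * (2 / e) * enorm (x - y) + 3 * (4 ^+ n * (2 / e) * enorm (x - y)).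
  by rewrite exprS; ring.
apply: lerD => //; rewrite normrM [`|2^-1|]ger0_norm//.
have four : 4 ^+ n = 2 ^+ n * 2 ^+ n :> R by rewrite -exprMn -natrM.
apply: (@le_trans _ _
  (2 / e * (2 * 2 ^+ n * enorm (x - y)) / 2 * (2 * 2 ^+ n))).
  by apply: ler_pM => //; rewrite ?mulr_ge0 ?enorm_ge0// ler_wpM2r.
have := mulr_ge0 (smoothness_ge0 n e0) (enorm_ge0 (x - y)); rewrite four.
lra.
Qed.

(** * Depth of a node, and induction over the circuit *)

Definition depth (R : realType) (d : nat) (C : linear_circuit R d)
    (v : node C) : nat :=
  #|[set u | connect (edge (@node_gate R d C)) u v & u != v]|.

(** The proper ancestors of [u] are also proper ancestors of [v], acyclicity excluding [v] itself;
    [u] is one more. Depth can thus drive the induction without any recursion along the graph. *)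
Lemma depth_edge (R : realType) (d : nat) (C : linear_circuit R d)
    (u v : node C) :
  edge (@node_gate R d C) u v -> (depth u < depth v)%N.
Proof.
move=> uv; apply: proper_card; apply/properP; split.
  apply/fintype.subsetP => w; rewrite !inE => /andP[wu wNu].
  rewrite (connect_trans wu (connect1 uv))/=.
  by apply: contraTneq wu => ->; exact: circuit_acyclic.
exists u; rewrite inE ?eqxx ?andbF// connect1//=.
by apply: contraTneq (circuit_acyclic uv) => ->; rewrite connect0.
Qed.

Lemma depth_lt_size (R : realType) (d : nat) (C : linear_circuit R d)
    (v : node C) :
  (depth v < circuit_size C)%N.
Proof.
rewrite /circuit_size -cardsT; apply: proper_card; rewrite properT.
by apply/eqP => /setP/(_ v); rewrite !inE eqxx andbF.
Qed.

Lemma circuit_smooth_approx (R : realType) (d : nat) (C : linear_circuit R d)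
    (e : R) (F : node C -> 'rV[R]_d -> R) (K : node C -> R) (v : node C) :
  0 < e -> computed_functions F -> recursive_constants K ->
  exists g, smooth_approx e (depth v) (K v) (F v) g.
Proof.
move=> e0 FE KE; have [n] := ubnP (depth v).
elim: n v => // n IH v; rewrite ltnS => vn.
(* All sources of [v] are widened to the index just below its depth, as the lemmas on [Add] and
   [Max] want equal indices. *)
have pred u : edge (@node_gate R d C) u v ->
    exists g, smooth_approx e (depth v).-1 (K u) (F u) g.
  move=> uv; have duv := depth_edge uv.
  have [g ga] := IH u (leq_trans duv vn).
  exists g; apply: smooth_approx_widen ga => //.
  by rewrite -ltnS (ltn_predK duv).
have -> : F v = fun x => match node_gate v with
    | Input i => x 0 i
    | Add u w => F u x + F w x
    | Max u w => Num.max (F u x) (F w x)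
    | Scale c u => c * F u x
    | Const c => c
    | Output u => F u x
    end by apply/funext => x; rewrite FE.
rewrite KE; have := circuit_bounded v; move: pred; rewrite /edge.
(* The predecessor of the depth is genuine only when [v] has a source, as the depth may be 0
   otherwise. *)
have depthS u : u \in sources (node_gate v) -> (depth v).-1.+1 = depth v.
  by move=> /depth_edge /ltn_predK.
move: depthS; case: (node_gate v) => [i|u w|u w|c u|c|u] /= depthS pred bnd.
- by exists (fun x => x 0 i); exact: smooth_approx_input.
- have [g ga] := pred u (mem_head _ _).
  have [h ha] := pred w (mem_last u [:: w]).
  exists (fun x => g x + h x).
  by rewrite -(depthS u) ?mem_head//; exact: smooth_approxD.
- have [g ga] := pred u (mem_head _ _).
  have [h ha] := pred w (mem_last u [:: w]).
  exists (fun x => smooth_max e (g x) (h x)).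
  by rewrite -(depthS u) ?mem_head//; exact: smooth_approx_max.
- have [g ga] := pred u (mem_head _ _).
  exists (fun x => c * g x); apply: smooth_approxZ => //.
    by rewrite ler_norml; rewrite in_itv in bnd.
  exact: smooth_approx_widen (leq_pred _) ga.
- by exists (fun=> c); exact: smooth_approx_cst.
- have [g ga] := pred u (mem_head _ _).
  by exists g; exact: smooth_approx_widen (leq_pred _) ga.
Qed.

Theorem theorem6p1 (R : realType) (d : nat) (C : linear_circuit R d)
    (f : 'rV[R]_d -> R) (L : R) (f_lip : recursively_lipschitz C f L) (N : R) :
  exists g : 'rV[R]_d -> R,
    [/\ forall x : 'rV[R]_d, `|f x - g x| <= 2 `^ (- N),
        elipschitz L g &
        esmooth (2 `^ (3 * (circuit_size C)%:R + N)) g].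
Proof.
have [F [K [FE KE _ -> ->]]] := f_lip.
set n := depth (output C).
have nC : (n < circuit_size C)%N := depth_lt_size _.
have pow0 r : 0 < 2 `^ r :> R by rewrite powR_gt0.
have powD r s : 2 `^ (r + s) = 2 `^ r * 2 `^ s :> R.
  by rewrite powRD// pnatr_eq0 implybT.
(* With [e = 2 ^ (- N - n)], the error [(2 ^ n - 1) * e] stays below [2 ^ (- N)]. *)
have [g [err lip _ _ [dg smo]]] :=
  circuit_smooth_approx (output C) (pow0 (- N - n%:R)) FE KE.
exists g; split=> // [x|].
  rewrite (le_trans (err x))// powD !powRN powR_mulrn// mulrCA.
  rewrite ler_piMr ?invr_ge0 ?powR_ge0//.
  by rewrite -/n ler_pdivrMr ?exprn_gt0// mul1r lerBlDr lerDl.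
split=> // x y; rewrite (le_trans (smo x y))// ler_wpM2r ?enorm_ge0//.
rewrite -/n -powRN opprD !opprK.
(* The exponent collects [2 n] from [4 ^+ n], 1 from the factor 2, and [N + n] from [1 / e]. *)
have -> : 4 ^+ n * (2 * 2 `^ (N + n%:R)) = 2 `^ ((3 * n + 1)%:R + N) :> R.
  rewrite !powD !powR_mulrn// exprD exprM expr1 (_ : 2 ^+ 3 = 4 * 2 :> R).
    by rewrite exprMn; ring.
  by ring.
rewrite ler_powR ?ler1n// lerD2r -natrM ler_nat.
(* The strict inequality between [n] and the size absorbs the extra 1: [3 n + 1 <= 3 (n + 1)]. *)
by rewrite -[circuit_size C](ltn_predK nC) mulnS; lia.
Qed.
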